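(* Let $\mathcal{A}$ be a Hopf algebra, let $(\Gamma,d)$ be a finite dimensional left-covariant first order differential calculus over $\mathcal{A}$, let $\{\omega_1,\dots,\omega_n\}$ be a basis of the vector space of left-invariant elements of $\Gamma$, and let $X_k,f^k_l\in\mathcal{A}^\circ$ $(k,l=1,\dots,n)$ be the associated functionals, i.e. $da=\sum_k (X_k\triangleright a)\,\omega_k$ and $\omega_k a=\sum_j (f^k_j\triangleright a)\,\omega_j$ for $a\in\mathcal{A}$. Let $\mathcal{A}_{n+1}=\mathcal{A}\oplus\dots\oplus\mathcal{A}$ ($n+1$ summands), let $C\in L(\mathcal{A}_{n+1})$ be the operator $$C(b_0,b_1,\dots,b_n)=\Big(\sum_{k=1}^n X_k\triangleright b_k,\; X_1\triangleright b_0,\;\dots,\;X_n\triangleright b_0\Big),$$ and let $\rho:\mathcal{A}\to L(\mathcal{A}_{n+1})$ be the algebra homomorphism $\rho(a)(b_0,\dots,b_n)=(ab_0,\dots,ab_n)$. Then the pair $(\rho,C)$ is a faithful algebraic commutator representation of $\Gamma$ with $\mathcal{B}=L(\mathcal{A}_{n+1})$.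
   Context: All algebras are unital and over $\mathbb{C}$; algebra homomorphisms preserve units. $L(V)$ is the algebra of linear mappings of a vector space $V$ into itself. A first order differential calculus (FODC) over an algebra $\mathcal{A}$ is an $\mathcal{A}$-bimodule $\Gamma$ with a linear mapping $d:\mathcal{A}\to\Gamma$ such that $d(ab)=a\,db+da\,b$ for $a,b\in\mathcal{A}$ and $\Gamma=\mathrm{Lin}\{a\,db:\ a,b\in\mathcal{A}\}$. If $\mathcal{A}$ is a Hopf algebra, a FODC $\Gamma$ is left-covariant if there is a linear map $\Delta_L:\Gamma\to\mathcal{A}\otimes\Gamma$ with $\Delta_L(a\,db)=\Delta(a)(\mathrm{id}\otimes d)\Delta(b)$; an element $\omega\in\Gamma$ is left-invariant if $\Delta_L(\omega)=1\otimes\omega$. $\Gamma$ is finite dimensional if its space of left-invariant elements is finite dimensional. $\mathcal{A}^\circ$ denotes the dual Hopf algebra of $\mathcal{A}$ (product $(fg)(a)=f(a_{(1)})g(a_{(2)})$, Sweedler notation), and $f\triangleright a=a_{(1)}\langle f,a_{(2)}\rangle$ for $f\in\mathcal{A}^\circ$, $a\in\mathcal{A}$. For a finite dimensional left-covariant FODC with a basis $\{\omega_k\}$ of left-invariant elements, functionals $X_k,f^k_l\in\mathcal{A}^\circ$ satisfying the two formulas in the claim exist. Let $\rho:\mathcal{A}\to\mathcal{B}$ be an algebra homomorphism into an algebra $\mathcal{B}$ and $C\in\mathcal{B}$. The pair $(\rho,C)$ is an algebraic commutator representation of a FODC $\Gamma$ over $\mathcal{A}$ if there exists a (well-defined) linear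 mapping $\tau:\Gamma\to\mathcal{B}$ such that $\tau(a\,db)=i\rho(a)(C\rho(b)-\rho(b)C)$ for all $a,b\in\mathcal{A}$. It is faithful if $\tau$ is injective. *)

(* Defs.v *)
From HB Require Import structures.
From mathcomp Require Import all_boot all_order all_algebra.
From mathcomp Require Import boolp reals complex.

Set Implicit Arguments.
Unset Strict Implicit.
Unset Printing Implicit Defensive.

Import GRing.Theory.
Local Open Scope ring_scope.

(* Tensor products of K-vector spaces: [:: (u_1, v_1); ...; (u_m, v_m)]      *)
(* stands for the sum of the u_i (x) v_i; no coefficients are needed, as      *)
(* c (u (x) v) = (c u) (x) v.                                                 *)
(* tens_rel is the congruence of the free commutative monoid on U * V that    *)
(* bilinearity generates; its quotient is a group because of tens_zero.       *)
Inductive tens_rel (K : fieldType) (U V : lmodType K) :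
    seq (U * V) -> seq (U * V) -> Prop :=
| tens_refl s : tens_rel s s
| tens_sym s t : tens_rel s t -> tens_rel t s
| tens_trans s t r : tens_rel s t -> tens_rel t r -> tens_rel s r
| tens_cat s s' t t' :
    tens_rel s s' -> tens_rel t t' -> tens_rel (s ++ t) (s' ++ t')
| tens_comm s t : tens_rel (s ++ t) (t ++ s)
| tens_zero v : tens_rel [:: (0, v)] [::]
| tens_addl u u' v : tens_rel [:: (u + u', v)] [:: (u, v); (u', v)]
| tens_addr u v v' : tens_rel [:: (u, v + v')] [:: (u, v); (u, v')]
| tens_scale c u v : tens_rel [:: (c *: u, v)] [:: (u, c *: v)].

Section Tensor.
Variables (K : fieldType) (U V : lmodType K).

Definition tens_eqb (s t : seq (U * V)) : bool := `[< tens_rel s t >].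

Lemma tens_eqb_refl : reflexive tens_eqb.
Proof. by move=> s; apply/asboolP; exact: tens_refl. Qed.

Lemma tens_eqb_sym : symmetric tens_eqb.
Proof. by move=> s t; apply/asboolP/asboolP; exact: tens_sym. Qed.

Lemma tens_eqb_trans : transitive tens_eqb.
Proof.
move=> s t r /asboolP ts /asboolP sr; apply/asboolP; exact: tens_trans ts sr.
Qed.

Canonical tens_equiv :=
  EquivRel tens_eqb tens_eqb_refl tens_eqb_sym tens_eqb_trans.

Definition tensor : Type := {eq_quot tens_equiv}%qT.
HB.instance Definition _ : EqQuotient _ tens_equiv tensor := EqQuotient.on tensor.
HB.instance Definition _ := Choice.on tensor.

Definition tcls (s : seq (U * V)) : tensor := (\pi_tensor s)%qT.
Definition tprod (u : U) (v : V) : tensor := tcls [:: (u, v)].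

Lemma tclsP s t : tcls s = tcls t <-> tens_rel s t.
Proof.
split=> [/eqP|st]; first by rewrite /tcls eqmodE => /asboolP.
by apply/eqP; rewrite /tcls eqmodE; apply/asboolP.
Qed.

Lemma tcls_repr (x : tensor) : tcls (repr x) = x.
Proof. exact: reprK. Qed.

Definition tscale_seq (c : K) (s : seq (U * V)) := [seq (c *: p.1, p.2) | p <- s].

Lemma tens_rel_scale c s t :
  tens_rel s t -> tens_rel (tscale_seq c s) (tscale_seq c t).
Proof.
elim=> {s t}.
- by move=> s; exact: tens_refl.
- by move=> s t _; exact: tens_sym.
- by move=> s t r _ st _; exact: tens_trans.
- move=> s s' t t' _ ss' _ tt'; rewrite /tscale_seq !map_cat; exact: tens_cat.
- move=> s t; rewrite /tscale_seq !map_cat; exact: tens_comm.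
- by move=> v /=; rewrite scaler0; exact: tens_zero.
- by move=> u u' v /=; rewrite scalerDr; exact: tens_addl.
- by move=> u v v' /=; exact: tens_addr.
- move=> a u v /=; rewrite scalerA mulrC -scalerA; exact: tens_scale.
Qed.

Definition tzero : tensor := tcls [::].
Definition tadd (x y : tensor) : tensor := tcls (repr x ++ repr y).
Definition tscale (c : K) (x : tensor) : tensor := tcls (tscale_seq c (repr x)).
Definition topp (x : tensor) : tensor := tscale (-1) x.

Lemma taddE s t : tadd (tcls s) (tcls t) = tcls (s ++ t).
Proof. by apply/tclsP; apply: tens_cat; apply/tclsP; exact: tcls_repr. Qed.

Lemma tscaleE c s : tscale c (tcls s) = tcls (tscale_seq c s).
Proof. by apply/tclsP; apply: tens_rel_scale; apply/tclsP; exact: tcls_repr. Qed.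

Lemma taddA : associative tadd.
Proof.
move=> x y z; rewrite -(tcls_repr x) -(tcls_repr y) -(tcls_repr z).
by rewrite !taddE catA.
Qed.

Lemma taddC : commutative tadd.
Proof.
move=> x y; rewrite -(tcls_repr x) -(tcls_repr y) !taddE.
by apply/tclsP; exact: tens_comm.
Qed.

Lemma tadd0 : left_id tzero tadd.
Proof. by move=> x; rewrite -(tcls_repr x) taddE. Qed.

Lemma tscale0_seq s : tens_rel (tscale_seq 0 s) [::].
Proof.
elim: s => [|[u v] s IHs] /=; first exact: tens_refl.
rewrite -[_ :: _]/([:: (0 *: u, v)] ++ tscale_seq 0 s) scale0r.
by rewrite -[X in tens_rel _ X]/([::] ++ [::]); apply: tens_cat => //; exact: tens_zero.
Qed.

Lemma tscaleDl_seq a b s :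
  tens_rel (tscale_seq (a + b) s) (tscale_seq a s ++ tscale_seq b s).
Proof.
elim: s => [|[u v] s IHs] /=; first exact: tens_refl.
set sab := tscale_seq _ s in IHs *; set sa := tscale_seq a s in IHs *.
set sb := tscale_seq b s in IHs *.
apply: (@tens_trans _ _ _ _ ([:: (a *: u, v); (b *: u, v)] ++ (sa ++ sb))).
  rewrite -[X in tens_rel X _]/([:: ((a + b) *: u, v)] ++ sab) scalerDl.
  by apply: tens_cat IHs; exact: tens_addl.
rewrite -[X in tens_rel X _]/([:: (a *: u, v)] ++ ([:: (b *: u, v)] ++ (sa ++ sb))).
rewrite -[X in tens_rel _ X]/([:: (a *: u, v)] ++ (sa ++ ([:: (b *: u, v)] ++ sb))).
apply: tens_cat; first exact: tens_refl.
by rewrite !catA; apply: tens_cat (tens_refl _); exact: tens_comm.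
Qed.

Lemma taddN : left_inverse tzero topp tadd.
Proof.
move=> x; rewrite -(tcls_repr x) /topp tscaleE taddE; apply/tclsP.
have -> : repr x = tscale_seq 1 (repr x).
  by rewrite /tscale_seq -[LHS]map_id; apply: eq_map => -[u v]; rewrite /= scale1r.
set s := repr x; rewrite /tscale_seq -map_comp.
rewrite (_ : map _ s = tscale_seq (-1) s); last first.
  by apply: eq_map => -[u v] /=; rewrite scale1r.
apply: tens_trans (tens_sym (tscaleDl_seq (-1) 1 s)) _.
by rewrite addNr; exact: tscale0_seq.
Qed.

HB.instance Definition _ := GRing.isZmodule.Build tensor taddA taddC tadd0 taddN.

Lemma tscaleA a b x : tscale a (tscale b x) = tscale (a * b) x.
Proof.
rewrite -(tcls_repr x) !tscaleE; congr tcls; rewrite /tscale_seq -map_comp.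
by apply: eq_map => -[u v] /=; rewrite scalerA.
Qed.

Lemma tscale1 : left_id 1 tscale.
Proof.
move=> x; rewrite -(tcls_repr x) tscaleE; congr tcls.
by rewrite /tscale_seq -[RHS]map_id; apply: eq_map => -[u v]; rewrite /= scale1r.
Qed.

Lemma tscaleDr : right_distributive tscale +%R.
Proof.
move=> c x y; rewrite -(tcls_repr x) -(tcls_repr y) [_ + _]taddE !tscaleE.
by rewrite [RHS]taddE /tscale_seq map_cat.
Qed.

Lemma tscaleDl x : {morph tscale^~ x : a b / a + b}.
Proof.
move=> a b; rewrite -(tcls_repr x) !tscaleE [RHS]taddE.
by apply/tclsP; exact: tscaleDl_seq.
Qed.

HB.instance Definition _ := GRing.Zmodule_isLmodule.Build K tensor
  tscaleA tscale1 tscaleDr tscaleDl.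

Lemma tcls_cat s t : tcls (s ++ t) = tcls s + tcls t.
Proof. by rewrite -taddE. Qed.

Lemma tcls_scale c s : tcls (tscale_seq c s) = c *: tcls s.
Proof. by rewrite -tscaleE. Qed.

Lemma tcls_sum s : tcls s = \sum_(p <- s) tprod p.1 p.2.
Proof.
elim: s => [|[u v] s IHs]; first by rewrite big_nil.
by rewrite big_cons -IHs -tcls_cat.
Qed.

Lemma tensor_sum (x : tensor) : x = \sum_(p <- repr x) tprod p.1 p.2.
Proof. by rewrite -tcls_sum tcls_repr. Qed.

Lemma tprod_bilinear : bilinear_for *:%R *:%R tprod.
Proof.
split=> [v|u] c x y; rewrite /tprod /=.
  by rewrite -tcls_scale -tcls_cat; apply/tclsP; exact: tens_addl.
rewrite -tcls_scale -tcls_cat; apply/tclsP.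
apply: tens_trans (tens_addr _ _ _) _.
rewrite -[X in tens_rel X _]/([:: (u, c *: x)] ++ [:: (u, y)]).
by apply: tens_cat (tens_refl _); exact/tens_sym/tens_scale.
Qed.
HB.instance Definition _ :=
  bilinear_isBilinear.Build K U V tensor *:%R *:%R tprod tprod_bilinear.

Section Lift.
Variables (W : lmodType K) (b : {bilinear U -> V -> W}).

(* The linear map with u (x) v |-> b u v, see tliftE.                         *)
Definition tlift (x : tensor) : W := \sum_(p <- repr x) b p.1 p.2.

Lemma tlift_rel s t : tens_rel s t ->
  \sum_(p <- s) b p.1 p.2 = \sum_(p <- t) b p.1 p.2.
Proof.
elim=> {s t} //.
- by move=> s t r _ -> _ ->.
- by move=> s s' t t' _ ss' _ tt'; rewrite !big_cat ss' tt'.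
- by move=> s t; rewrite !big_cat /= addrC.
- by move=> v; rewrite big_seq1 big_nil linear0l.
- by move=> u u' v; rewrite !big_cons big_nil !addr0 linearDl.
- by move=> u v v'; rewrite !big_cons big_nil !addr0 linearDr.
- by move=> c u v; rewrite !big_seq1 linearZl_LR linearZr_LR.
Qed.

Lemma tlift_cls s : tlift (tcls s) = \sum_(p <- s) b p.1 p.2.
Proof. by apply: tlift_rel; apply/tclsP; exact: tcls_repr. Qed.

Lemma tliftE u v : tlift (tprod u v) = b u v.
Proof. by rewrite tlift_cls big_seq1. Qed.

Lemma tlift_linear : linear tlift.
Proof.
move=> c x y; rewrite -(tcls_repr x) -(tcls_repr y) -tcls_scale -tcls_cat !tlift_cls big_cat /= big_map /= scaler_sumr.
by congr (_ + _); apply: eq_bigr => p _; rewrite linearZl_LR.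
Qed.
HB.instance Definition _ := GRing.isLinear.Build K tensor W *:%R tlift tlift_linear.

End Lift.

Lemma eq_tensor_linear (W : lmodType K) (f g : {linear tensor -> W}) :
  (forall u v, f (tprod u v) = g (tprod u v)) -> f =1 g.
Proof.
move=> fg x; rewrite (tensor_sum x) !linear_sum.
by apply: eq_bigr => p _; exact: fg.
Qed.

End Tensor.

Section TensorMaps.
Variable K : fieldType.

Section Map.
Variables (U U' V V' : lmodType K).
Variables (f : {linear U -> U'}) (g : {linear V -> V'}).

Definition tmap_fun (u : U) (v : V) : tensor U' V' := tprod (f u) (g v).

Lemma tmap_bilinear : bilinear_for *:%R *:%R tmap_fun.
Proof.
by split=> [v|u] c x y; rewrite /tmap_fun linearP ?linearPl ?linearPr.
Qed.
HB.instance Definition _ :=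
  bilinear_isBilinear.Build K U V (tensor U' V') *:%R *:%R tmap_fun tmap_bilinear.

Definition tmap : {linear tensor U V -> tensor U' V'} := tlift tmap_fun.

Lemma tmapE u v : tmap (tprod u v) = tprod (f u) (g v).
Proof. exact: tliftE. Qed.

End Map.

Section Assoc.
Variables (U V W : lmodType K).

Definition tassoc_in (w : W) (u : U) (v : V) : tensor U (tensor V W) :=
  tprod u (tprod v w).

Lemma tassoc_in_bilinear w : bilinear_for *:%R *:%R (tassoc_in w).
Proof.
by split=> [v|u] c x y; rewrite /tassoc_in ?linearPl ?linearPr.
Qed.
HB.instance Definition _ w :=
  bilinear_isBilinear.Build K U V (tensor U (tensor V W)) *:%R *:%R (tassoc_in w)
    (tassoc_in_bilinear w).

Definition tassoc_fun (x : tensor U V) (w : W) : tensor U (tensor V W) :=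
  tlift (tassoc_in w) x.

Lemma tassoc_bilinear : bilinear_for *:%R *:%R tassoc_fun.
Proof.
split=> [w|x] c y z; rewrite /tassoc_fun; first exact: linearP.
rewrite (tensor_sum x) !linear_sum /= scaler_sumr -big_split.
by apply: eq_bigr => p _; rewrite !tliftE /= /tassoc_in !linearPr.
Qed.
HB.instance Definition _ :=
  bilinear_isBilinear.Build K (tensor U V) W (tensor U (tensor V W)) *:%R *:%R
    tassoc_fun tassoc_bilinear.

Definition tassoc : {linear tensor (tensor U V) W -> tensor U (tensor V W)} :=
  tlift tassoc_fun.

Lemma tassocE u v w : tassoc (tprod (tprod u v) w) = tprod u (tprod v w).
Proof. by rewrite /tassoc /= tliftE /= /tassoc_fun tliftE. Qed.

End Assoc.

Section Contract.
Variables U V : lmodType K.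

Definition tslicel_fun (f : {scalar U}) (u : U) (v : V) : V := f u *: v.
Definition tslicer_fun (f : {scalar V}) (u : U) (v : V) : U := f v *: u.

Lemma tslicel_bilinear f : bilinear_for *:%R *:%R (tslicel_fun f).
Proof.
split=> [v|u] c x y; rewrite /tslicel_fun /=; first by rewrite linearP scalerDl scalerA.
by rewrite scalerDr !scalerA mulrC.
Qed.
Lemma tslicer_bilinear f : bilinear_for *:%R *:%R (tslicer_fun f).
Proof.
split=> [v|u] c x y; rewrite /tslicer_fun /=; last by rewrite linearP scalerDl scalerA.
by rewrite scalerDr !scalerA mulrC.
Qed.
HB.instance Definition _ f := bilinear_isBilinear.Build K U V V *:%R *:%R
  (tslicel_fun f) (tslicel_bilinear f).
HB.instance Definition _ f := bilinear_isBilinear.Build K U V U *:%R *:%R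
  (tslicer_fun f) (tslicer_bilinear f).

(* f (x) id and id (x) f, with K (x) V = V and U (x) K = U identified.        *)
Definition tslicel (f : {scalar U}) : {linear tensor U V -> V} := tlift (tslicel_fun f).
Definition tslicer (f : {scalar V}) : {linear tensor U V -> U} := tlift (tslicer_fun f).

Lemma tslicelE f u v : tslicel f (tprod u v) = f u *: v.
Proof. exact: tliftE. Qed.
Lemma tslicerE f u v : tslicer f (tprod u v) = f v *: u.
Proof. exact: tliftE. Qed.

End Contract.

Section Product.
Variables U U' U2 V V' V2 : lmodType K.
Variables (b : {bilinear U -> U' -> U2}) (g : {bilinear V -> V' -> V2}).

Definition tbilin_fun (y : tensor U' V') (u : U) (v : V) : tensor U2 V2 :=
  tmap (b u) (g v) y.

Lemma tbilin_bilinear y : bilinear_for *:%R *:%R (tbilin_fun y).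
Proof.
split=> [v|u] c x x'; rewrite /tbilin_fun (tensor_sum y) !linear_sum /=
  scaler_sumr -big_split; apply: eq_bigr => p _; rewrite /= !tmapE /=.
  by rewrite !linearPl.
by rewrite linearPl linearPr.
Qed.
HB.instance Definition _ y := bilinear_isBilinear.Build K U V (tensor U2 V2)
  *:%R *:%R (tbilin_fun y) (tbilin_bilinear y).

(* (u (x) v, u' (x) v') |-> b u u' (x) g v v', see tbilinE.                   *)
Definition tbilin (x : tensor U V) (y : tensor U' V') : tensor U2 V2 :=
  tlift (tbilin_fun y) x.

Lemma tbilinE u v u' v' :
  tbilin (tprod u v) (tprod u' v') = tprod (b u u') (g v v').
Proof. by rewrite /tbilin tliftE /= /tbilin_fun tmapE. Qed.

Lemma tbilin_is_bilinear : bilinear_for *:%R *:%R tbilin.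
Proof.
split=> [y|x] c z z'; rewrite /tbilin; first exact: linearP.
rewrite (tensor_sum x) !linear_sum /= scaler_sumr -big_split.
by apply: eq_bigr => p _; rewrite !tliftE /= /tbilin_fun linearP.
Qed.
HB.instance Definition _ := bilinear_isBilinear.Build K (tensor U V) (tensor U' V')
  (tensor U2 V2) *:%R *:%R tbilin tbilin_is_bilinear.

End Product.
End TensorMaps.

Section AlgMul.
Variables (K : fieldType) (A : algType K).

Definition amul (a b : A) : A := a * b.

Lemma amul_bilinear : bilinear_for *:%R *:%R amul.
Proof.
split=> [v|u] c x y; rewrite /amul /=; first by rewrite mulrDl scalerAl.
by rewrite mulrDr scalerAr.
Qed.
HB.instance Definition _ :=
  bilinear_isBilinear.Build K A A A *:%R *:%R amul amul_bilinear.

End AlgMul.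

HB.mixin Record Algebra_isHopf (K : fieldType) A of GRing.Algebra K A := {
  coprod : {linear A -> tensor A A};
  counit : {scalar A};
  antipode : {linear A -> A};
  coprodA : forall a : A,
    tassoc A A A (tmap coprod idfun (coprod a)) = tmap idfun coprod (coprod a);
  counitl : forall a : A, tslicel A counit (coprod a) = a;
  counitr : forall a : A, tslicer A counit (coprod a) = a;
  coprod1 : coprod 1 = tprod (1 : A) (1 : A);
  coprodM : forall a b : A,
    coprod (a * b) = tbilin (@amul K A) (@amul K A) (coprod a) (coprod b);
  counit1 : counit 1 = 1;
  counitM : forall a b : A, counit (a * b) = counit a * counit b;
  antipodel : forall a : A,
    tlift (@amul K A) (tmap antipode idfun (coprod a)) = (counit a)%:A;
  antipoder : forall a : A,
    tlift (@amul K A) (tmap idfun antipode (coprod a)) = (counit a)%:A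
}.

#[short(type="hopfAlgType")]
HB.structure Definition HopfAlgebra (K : fieldType) :=
  {A of Algebra_isHopf K A & GRing.Algebra K A}.

Section HopfDual.
Variables (K : fieldType) (A : hopfAlgType K).

(* Membership in the dual Hopf algebra of A: the functional a (x) b |-> f (ab)*)
(* lies in the algebraic tensor product of two copies of the dual space.      *)
Definition hopf_dual (f : {scalar A}) : Prop :=
  exists (r : nat) (g h : 'I_r -> {scalar A}),
    forall a b : A, f (a * b) = \sum_(i < r) g i a * h i b.

(* f |> a = a_(1) <f, a_(2)>                                                  *)
Definition lhit (f : {scalar A}) (a : A) : A := tslicer A f (coprod a).

Lemma lhit_linear f : linear (lhit f).
Proof. by move=> c a b; rewrite /lhit !linearP. Qed.
HB.instance Definition _ f := GRing.isLinear.Build K A A *:%R (lhit f) (lhit_linear f).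

End HopfDual.

HB.mixin Record Lmodule_isBimodule (K : fieldType) (A : algType K) G
    of GRing.Lmodule K G := {
  lact : {bilinear A -> G -> G};
  ract : {bilinear G -> A -> G};
  lact1 : forall w : G, lact 1 w = w;
  lactM : forall (a b : A) (w : G), lact (a * b) w = lact a (lact b w);
  ract1 : forall w : G, ract w 1 = w;
  ractM : forall (w : G) (a b : A), ract w (a * b) = ract (ract w a) b;
  lactC : forall (a : A) (w : G) (b : A), ract (lact a w) b = lact a (ract w b)
}.

#[short(type="bimodType")]
HB.structure Definition Bimodule (K : fieldType) (A : algType K) :=
  {G of Lmodule_isBimodule K A G & GRing.Lmodule K G}.

Definition in_span (K : fieldType) (V : lmodType K) (S : V -> Prop) (v : V) : Prop :=
  exists (m : nat) (c : 'I_m -> K) (s : 'I_m -> V),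
    (forall i, S (s i)) /\ v = \sum_(i < m) c i *: s i.

(* omega is a basis of the subspace of V with elements S.                     *)
Definition is_basis (K : fieldType) (V : lmodType K) (S : V -> Prop)
    (n : nat) (omega : 'I_n -> V) : Prop :=
  [/\ forall k, S (omega k),
      forall c : 'I_n -> K, \sum_(k < n) c k *: omega k = 0 -> forall k, c k = 0
    & forall v, S v -> exists c : 'I_n -> K, v = \sum_(k < n) c k *: omega k].

Definition is_fodc (K : fieldType) (A : algType K) (G : bimodType A)
    (d : {linear A -> G}) : Prop :=
  (forall a b : A, d (a * b) = lact a (d b) + ract (d a) b) /\
  (forall w : G, in_span (fun v => exists a b : A, v = lact a (d b)) w).

Section LeftCovariance.
Variables (K : fieldType) (A : hopfAlgType K) (G : bimodType A).

Definition is_left_coaction (d : {linear A -> G}) (dL : {linear G -> tensor A G}) :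
    Prop :=
  forall a b : A, dL (lact a (d b)) =
    tbilin (@amul K A) (@lact K A G) (coprod a) (tmap idfun d (coprod b)).

Definition left_invariant (dL : {linear G -> tensor A G}) (w : G) : Prop :=
  dL w = tprod 1 w.

End LeftCovariance.

(* The algebra L(V), with composition as product                              *)

Section LinEnd.
Variables (K : fieldType) (V : lmodType K).

Record linEnd := LinEnd { linEnd_fun :> V -> V; linEnd_linear : linear linEnd_fun }.

HB.instance Definition _ (f : linEnd) :=
  GRing.isLinear.Build K V V *:%R (linEnd_fun f) (linEnd_linear f).
HB.instance Definition _ := gen_eqMixin linEnd.
HB.instance Definition _ := gen_choiceMixin linEnd.

Lemma linEndP (f g : linEnd) : f =1 g -> f = g.
Proof.
case: f g => [f Hf] [g Hg] /= /funext fg; case: _ / fg Hg => Hg.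
by congr LinEnd; exact: Prop_irrelevance.
Qed.

Definition linEnd_zero := LinEnd (linearP (\0 : {linear V -> V})).
Definition linEnd_one := LinEnd (linearP (idfun : {linear V -> V})).
Definition linEnd_add (f g : linEnd) :=
  LinEnd (linearP ((f : V -> V) \+ g : {linear V -> V})).
Definition linEnd_opp (f : linEnd) :=
  LinEnd (linearP (\- (f : V -> V) : {linear V -> V})).
Definition linEnd_mul (f g : linEnd) :=
  LinEnd (linearP ((f : V -> V) \o g : {linear V -> V})).
Definition linEnd_scale (c : K) (f : linEnd) :=
  LinEnd (linearP (c \*: (f : V -> V) : {linear V -> V})).

Lemma linEnd_addA : associative linEnd_add.
Proof. by move=> f g h; apply: linEndP => v /=; rewrite addrA. Qed.
Lemma linEnd_addC : commutative linEnd_add.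
Proof. by move=> f g; apply: linEndP => v /=; rewrite addrC. Qed.
Lemma linEnd_add0 : left_id linEnd_zero linEnd_add.
Proof. by move=> f; apply: linEndP => v /=; rewrite add0r. Qed.
Lemma linEnd_addN : left_inverse linEnd_zero linEnd_opp linEnd_add.
Proof. by move=> f; apply: linEndP => v /=; rewrite addNr. Qed.
HB.instance Definition _ :=
  GRing.isZmodule.Build linEnd linEnd_addA linEnd_addC linEnd_add0 linEnd_addN.

Lemma linEnd_mulA : associative linEnd_mul.
Proof. by move=> f g h; apply: linEndP. Qed.
Lemma linEnd_mul1l : left_id linEnd_one linEnd_mul.
Proof. by move=> f; apply: linEndP. Qed.
Lemma linEnd_mul1r : right_id linEnd_one linEnd_mul.
Proof. by move=> f; apply: linEndP. Qed.
Lemma linEnd_mulDl : left_distributive linEnd_mul linEnd_add.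
Proof. by move=> f g h; apply: linEndP. Qed.
Lemma linEnd_mulDr : right_distributive linEnd_mul linEnd_add.
Proof. by move=> f g h; apply: linEndP => v /=; rewrite linearD. Qed.
HB.instance Definition _ := GRing.Zmodule_isPzRing.Build linEnd
  linEnd_mulA linEnd_mul1l linEnd_mul1r linEnd_mulDl linEnd_mulDr.

Lemma linEnd_scaleA a b (f : linEnd) :
  linEnd_scale a (linEnd_scale b f) = linEnd_scale (a * b) f.
Proof. by apply: linEndP => v /=; rewrite scalerA. Qed.
Lemma linEnd_scale1 : left_id 1 linEnd_scale.
Proof. by move=> f; apply: linEndP => v /=; rewrite scale1r. Qed.
Lemma linEnd_scaleDr : right_distributive linEnd_scale +%R.
Proof. by move=> c f g; apply: linEndP => v /=; rewrite scalerDr. Qed.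
Lemma linEnd_scaleDl (f : linEnd) : {morph linEnd_scale^~ f : a b / a + b}.
Proof. by move=> a b; apply: linEndP => v /=; rewrite scalerDl. Qed.
HB.instance Definition _ := GRing.Zmodule_isLmodule.Build K linEnd
  linEnd_scaleA linEnd_scale1 linEnd_scaleDr linEnd_scaleDl.

End LinEnd.

Section DirectSum.
Variables (K : fieldType) (A : algType K) (n : nat).

(* The direct sum of n + 1 copies of A.                                       *)
Definition dsum : Type := {ffun 'I_n.+1 -> A}.
HB.instance Definition _ := GRing.Lmodule.on dsum.

(* The library's algebras are nonzero rings, which L(V) is only for V <> 0.   *)
Lemma linEnd_dsum_neq0 : (1 : linEnd dsum) != 0.
Proof.
apply/eqP => /(congr1 (fun f : linEnd dsum => f [ffun=> 1] ord0)) /=.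
by rewrite !ffunE => /eqP; rewrite oner_eq0.
Qed.
HB.instance Definition _ := GRing.PzSemiRing_isNonZero.Build (linEnd dsum)
  linEnd_dsum_neq0.

Lemma linEnd_dsum_scaleAl c (f g : linEnd dsum) : c *: (f * g) = (c *: f) * g.
Proof. exact: linEndP. Qed.
Lemma linEnd_dsum_scaleAr c (f g : linEnd dsum) : c *: (f * g) = f * (c *: g).
Proof. by apply: linEndP => v /=; rewrite linearZ. Qed.
HB.instance Definition _ := GRing.Lmodule_isLalgebra.Build K (linEnd dsum)
  linEnd_dsum_scaleAl.
HB.instance Definition _ := GRing.Lalgebra_isAlgebra.Build K (linEnd dsum)
  linEnd_dsum_scaleAr.

Definition diag_mul_fun (a : A) (b : dsum) : dsum := [ffun i => a * b i].

Lemma diag_mul_linear a : linear (diag_mul_fun a).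
Proof. by move=> c x y; apply/ffunP => i; rewrite !ffunE mulrDr scalerAr. Qed.

Definition diag_mul (a : A) : linEnd dsum := LinEnd (diag_mul_linear a).

Lemma diag_mul_is_linear : linear diag_mul.
Proof.
move=> c a b; apply: linEndP => x; apply/ffunP => i.
by rewrite !ffunE mulrDl scalerAl.
Qed.
HB.instance Definition _ :=
  GRing.isLinear.Build K A (linEnd dsum) *:%R diag_mul diag_mul_is_linear.

Lemma diag_mul_monoid_morphism : monoid_morphism diag_mul.
Proof.
split=> [|a b]; apply: linEndP => x; apply/ffunP => i; rewrite !ffunE ?mul1r //.
by rewrite mulrA.
Qed.
HB.instance Definition _ :=
  GRing.isMonoidMorphism.Build A (linEnd dsum) diag_mul diag_mul_monoid_morphism.

End DirectSum.

Section CommutatorOperator.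
Variables (K : fieldType) (A : hopfAlgType K) (n : nat) (X : 'I_n -> {scalar A}).

(* b_0 is b ord0, and b_k (k = 1, ..., n) is b (lift ord0 (k - 1)).           *)
Definition commutator_op_fun (b : dsum A n) : dsum A n :=
  [ffun i => if unlift ord0 i is Some k then lhit (X k) (b ord0)
             else \sum_(k < n) lhit (X k) (b (lift ord0 k))].

Lemma commutator_op_linear : linear commutator_op_fun.
Proof.
move=> c x y; apply/ffunP => i; rewrite !ffunE; case: (unlift ord0 i) => [k|].
  by rewrite linearP.
rewrite scaler_sumr -big_split; apply: eq_bigr => k _ /=.
by rewrite !ffunE linearP.
Qed.

Definition commutator_op : linEnd (dsum A n) := LinEnd commutator_op_linear.

End CommutatorOperator.

Section CommutatorRepresentation.
Variables (R : realType) (A : algType R[i]) (G : bimodType A) (d : {linear A -> G}).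
Variables (B : algType R[i]) (rho : {lrmorphism A -> B}) (C : B).

Definition commutator_map (tau : {linear G -> B}) : Prop :=
  forall a b : A,
    tau (lact a (d b)) = 'i%C *: (rho a * (C * rho b - rho b * C)).

Definition commutator_rep : Prop :=
  exists tau : {linear G -> B}, commutator_map tau.

Definition faithful_commutator_rep : Prop :=
  commutator_rep /\
  (forall tau : {linear G -> B}, commutator_map tau -> injective tau).

End CommutatorRepresentation.

(* Main.v *)
From HB Require Import structures.
Require Import Defs.
From mathcomp Require Import all_boot all_order all_algebra.
From mathcomp Require Import boolp reals complex.

Set Implicit Arguments.
Unset Strict Implicit.
Unset Printing Implicit Defensive.

Import GRing.Theory.
Local Open Scope ring_scope.

(** The idea is to recognise [C, rho(b)] as the right action of b on forms, read
    in coordinates.  A left-invariant basis omega freely generates Gamma as a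
    left A-module, so there are left A-linear coordinate maps
    e_k : Gamma -> A with w = sum_k e_k(w) omega_k (left_coord), and the first
    formula for d says that X_k |> a = e_k(da).  By the Leibniz rule,
      X_k |> (bc) - b (X_k |> c) = e_k(d(bc) - b dc) = e_k(db c).
    Hence tau(a db) = i rho(a) [C, rho(b)] is the value at w = a db of
      tau(w) (b_0, ..., b_n) =
        i (sum_k e_k(w b_k), e_1(w b_0), ..., e_n(w b_0)),
    a formula that is visibly linear in w and therefore defines tau on all of
    Gamma.  Evaluating at (1, 1, ..., 1) recovers i e_k(w) as the k-th
    component, so tau(w) = 0 forces w = sum_k e_k(w) omega_k = 0.

    The coordinates come from the Hopf algebra structure.  The coaction is a
    map of left A-modules, and the map w |-> S(w_(-1)) w_(0) sends a omega_k to
    epsilon(a) omega_k, by the antipode axiom; linear independence of the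
    omega_k over the field then gives functionals pi_k with
    pi_k(a omega_j) = epsilon(a) delta_jk (inv_proj_coord).  The map
    e_k := (id (x) pi_k) o Delta_L sends a omega_j to
    a_(1) epsilon(a_(2)) delta_jk = a delta_jk, by the counit axiom. *)

(** * The coaction and its invariant projection *)

Lemma tensor_ind (K : fieldType) (U V : lmodType K) (P : tensor U V -> Prop) :
    P 0 -> (forall x y, P x -> P y -> P (x + y)) ->
    (forall u v, P (tprod u v)) ->
  forall x, P x.
Proof. by move=> P0 PD Pt x; rewrite (tensor_sum x); apply: big_ind. Qed.

Section LeftModuleOfTensors.
Variables (K : fieldType) (A : hopfAlgType K) (G : bimodType A).

(** Gamma being a left A-module, A (x) Gamma is a left module over A (x) A; its
    associativity law is what makes the coaction a module map below. *)
Lemma tbilin_lactM (x y : tensor A A) (z : tensor A G) :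
  tbilin (@amul K A) (@lact K A G) (tbilin (@amul K A) (@amul K A) x y) z =
  tbilin (@amul K A) (@lact K A G) x (tbilin (@amul K A) (@lact K A G) y z).
Proof.
elim/tensor_ind: x => [|x x' IHx IHx'|a a'].
- by rewrite !linear0l.
- by rewrite !linearDl /= IHx IHx'.
elim/tensor_ind: y => [|y y' IHy IHy'|b b'].
- by rewrite linear0r !linear0l linear0r.
- by rewrite linearDr !linearDl linearDr /= IHy IHy'.
elim/tensor_ind: z => [|z z' IHz IHz'|c w].
- by rewrite !linear0r.
- by rewrite !linearDr /= IHz IHz'.
by rewrite !tbilinE /= /amul mulrA lactM.
Qed.

End LeftModuleOfTensors.

Lemma eq_linear_span (K : fieldType) (V W : lmodType K) (S : V -> Prop)
    (g h : {linear V -> W}) :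
    (forall v, in_span S v) -> (forall v, S v -> g v = h v) ->
  g =1 h.
Proof.
move=> spanS gh v; have [m [c [s [Ss ->]]]] := spanS v.
by rewrite !linear_sum; apply: eq_bigr => i _; rewrite !linearZ gh.
Qed.

Section LeftCovariantCalculus.
Variables (K : fieldType) (A : hopfAlgType K) (G : bimodType A).
Variables (d : {linear A -> G}) (dL : {linear G -> tensor A G}).
Hypothesis Gfodc : is_fodc d.
Hypothesis Gleft : is_left_coaction d dL.

(** The condition Delta_L (a db) = Delta(a) (id (x) d) Delta(b) only speaks of
    the forms a db. On w = b dc the two sides agree because the coproduct is
    multiplicative, and both sides are linear in w. *)
Lemma left_coaction_lact (a : A) (w : G) :
  dL (lact a w) = tbilin (@amul K A) (@lact K A G) (coprod a) (dL w).
Proof.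
pose g : {linear G -> tensor A G} := dL \o lact a.
pose act : {bilinear tensor A A -> tensor A G -> tensor A G} :=
  tbilin (@amul K A) (@lact K A G).
pose h : {linear G -> tensor A G} := act (coprod a) \o dL.
apply: (eq_linear_span (g := g) (h := h) (proj2 Gfodc)).
by move=> _ [b [c ->]] /=; rewrite -lactM !Gleft -tbilin_lactM coprodM.
Qed.

(** The map w |-> S(w_(-1)) w_(0), Woronowicz's projection onto the
    left-invariant forms. *)
Definition inv_proj : {linear G -> G} :=
  tlift (@lact K A G) \o tmap antipode idfun \o dL.

(** For invariant w, Delta_L (a w) = a_(1) (x) a_(2) w, so that the projection is
    S(a_(1)) a_(2) w, which the antipode axiom evaluates. *)
Lemma inv_proj_lact (a : A) (w : G) :
  left_invariant dL w -> inv_proj (lact a w) = counit a *: w.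
Proof.
move=> inv_w; rewrite /= left_coaction_lact inv_w.
have -> : counit a *: w = lact ((counit a)%:A : A) w.
  by rewrite linearZl_LR /= lact1.
rewrite -antipodel.
elim/tensor_ind: (coprod a) => [|x y IHx IHy|b c].
- by rewrite linear0l !linear0 linear0l.
- by rewrite !linearDl !linearD linearDl /= IHx IHy.
by rewrite tbilinE !tmapE /= !tliftE /= /amul mulr1 lactM.
Qed.

(** * Left-module coordinates of a form *)

Variables (n : nat) (omega : 'I_n -> G) (X : 'I_n -> {scalar A}).
Hypothesis Gbasis : is_basis (left_invariant dL) omega.
Hypothesis dX :
  forall a : A, d a = \sum_(k < n) lact (lhit (X k) a) (omega k).

Lemma inv_basis_generates (w : G) :
  exists a : 'I_n -> A, w = \sum_(k < n) lact (a k) (omega k).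
Proof.
have [m [c [s [Ss ->]]]] := proj2 Gfodc w.
have /choice[a sa] (i : 'I_m) :
    exists a : 'I_n -> A, s i = \sum_(k < n) lact (a k) (omega k).
  have [b [b' ->]] := Ss i; exists (fun k => b * lhit (X k) b').
  by rewrite dX linear_sum; apply: eq_bigr => k _; rewrite lactM.
exists (fun k => \sum_(i < m) c i *: a i k).
under [RHS]eq_bigr => k _ do rewrite linear_sumlz.
rewrite exchange_big /=; apply: eq_bigr => i _.
by rewrite sa scaler_sumr; apply: eq_bigr => k _; rewrite linearZl_LR.
Qed.

(** The functional pi_k takes the k-th coordinate of the invariant projection.
    That the projection lands in the span of omega is read off from
    generators: it maps sum_k a_k omega_k to sum_k epsilon(a_k) omega_k. *)
Lemma inv_proj_coord : exists pi : 'I_n -> {scalar G},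
  forall k j (a : A), pi k (lact a (omega j)) = counit a *+ (j == k).
Proof.
have [inv_omega free_omega _] := Gbasis.
have uniq_coord (c c' : 'I_n -> K) :
    \sum_(k < n) c k *: omega k = \sum_(k < n) c' k *: omega k -> c =1 c'.
  move=> /eqP; rewrite -subr_eq0 -sumrB => /eqP cc' k.
  apply/eqP; rewrite -subr_eq0; apply/eqP.
  apply: (free_omega (fun k => c k - c' k)); rewrite -[RHS]cc'.
  by apply: eq_bigr => j _; rewrite scalerBl.
have /choice[pi piP] (w : G) :
    exists c : 'I_n -> K, inv_proj w = \sum_(k < n) c k *: omega k.
  have [a ->] := inv_basis_generates w; exists (fun k => counit (a k)).
  by rewrite linear_sum; apply: eq_bigr => k _; rewrite inv_proj_lact.
have pi_linear k : scalar (fun w => pi w k).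
  move=> c w w'; apply: (uniq_coord _ (fun k => c * pi w k + pi w' k)).
  rewrite -piP linearP !piP scaler_sumr -big_split; apply: eq_bigr => j _.
  by rewrite scalerDl scalerA.
pose pil k := GRing.isLinear.Build K G K *%R (fun w => pi w k) (pi_linear k).
pose pis k : {scalar G} := HB.pack (fun w => pi w k) (pil k).
exists pis => k j a; apply: (uniq_coord _ (fun k => counit a *+ (j == k))).
rewrite -piP inv_proj_lact // (bigD1 j) //= eqxx big1 ?addr0 // => i.
by rewrite eq_sym => /negPf->; rewrite scale0r.
Qed.

(** Left-module freeness of Gamma on omega, in the form of A-linear coordinates.
    Slicing the coaction with pi_k turns a omega_j into
    a_(1) epsilon(a_(2)) delta_jk, and the counit axiom restores a. *)
Lemma left_coord : exists e : 'I_n -> {linear G -> A},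
  [/\ forall k (a : A) (w : G), e k (lact a w) = a * e k w,
      forall k (a : 'I_n -> A), e k (\sum_(j < n) lact (a j) (omega j)) = a k
    & forall w : G, w = \sum_(k < n) lact (e k w) (omega k)].
Proof.
have [inv_omega _ _] := Gbasis; have [pi piP] := inv_proj_coord.
pose e k : {linear G -> A} := tslicer A (pi k) \o dL.
have eE k j a : e k (lact a (omega j)) = a *+ (j == k).
  rewrite /= left_coaction_lact inv_omega -[in RHS](counitr a).
  elim/tensor_ind: (coprod a) => [|x y IHx IHy|b c].
  - by rewrite linear0l !linear0 mul0rn.
  - by rewrite linearDl !linearD /= IHx IHy mulrnDl.
  by rewrite tbilinE !tslicerE /= /amul mulr1 piP scalerMnl.
clearbody e.
have e_sum k (a : 'I_n -> A) : e k (\sum_(j < n) lact (a j) (omega j)) = a k.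
  rewrite linear_sum (bigD1 k) // big1 => [|j /negPf jk]; last by rewrite eE jk.
  by rewrite eE eqxx /= addr0.
exists e; split=> // [k a w|w]; have [b ->] := inv_basis_generates w.
  rewrite e_sum linear_sum -[RHS](e_sum k (fun j => a * b j)); congr (e k _).
  by apply: eq_bigr => j _; rewrite lactM.
by apply: eq_bigr => k _; rewrite e_sum.
Qed.

End LeftCovariantCalculus.

(** * The map tau *)

Section CommutatorRepresentation.
Variables (R : realType) (A : hopfAlgType R[i]) (G : bimodType A).
Variables (d : {linear A -> G}) (n : nat).
Variables (X : 'I_n -> {scalar A}) (e : 'I_n -> {linear G -> A}).

(** The operator C with each X_k |> b replaced by e_k(w b): as
    X_k |> b = e_k(db), the form w acting on b from the left takes the place
    of the differential of b. *)
Definition comm_tau_fun (w : G) (b : dsum A n) : dsum A n :=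
  [ffun i => if unlift ord0 i is Some k then e k (ract w (b ord0))
             else \sum_(k < n) e k (ract w (b (lift ord0 k)))].

Lemma comm_tau_fun_linear (w : G) : linear (comm_tau_fun w).
Proof.
move=> c x y; apply/ffunP => i; rewrite !ffunE; case: (unlift ord0 i) => [k|].
  by rewrite linearPr linearP.
rewrite scaler_sumr -big_split; apply: eq_bigr => k _.
by rewrite !ffunE linearPr linearP.
Qed.

Definition comm_tau (w : G) : linEnd (dsum A n) :=
  'i%C *: LinEnd (comm_tau_fun_linear w).

Lemma comm_tau_linear : linear comm_tau.
Proof.
move=> c x y; rewrite /comm_tau scalerA mulrC -scalerA -scalerDr.
congr (_ *: _); apply: linEndP => b; apply/ffunP => i; rewrite !ffunE /=.
case: (unlift ord0 i) => [k|]; first by rewrite linearPl linearP.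
rewrite scaler_sumr -big_split; apply: eq_bigr => k _.
by rewrite linearPl linearP.
Qed.
HB.instance Definition _ :=
  GRing.isLinear.Build R[i] G (linEnd (dsum A n)) *:%R comm_tau comm_tau_linear.

Hypothesis Gfodc : is_fodc d.
Hypothesis e_lact : forall k (a : A) (w : G), e k (lact a w) = a * e k w.
Hypothesis e_d : forall k (a : A), e k (d a) = lhit (X k) a.

(** C is a differential operator read through the e_k, so its commutator with
    multiplication by b keeps only the Leibniz term db c; the remaining factor
    a is absorbed by left A-linearity of the e_k. *)
Lemma comm_tau_commutator :
  commutator_map d (@diag_mul R[i] A n) (commutator_op X) comm_tau.
Proof.
have comm_X k (b c : A) :
    lhit (X k) (b * c) - b * lhit (X k) c = e k (ract (d b) c).
  by rewrite -!e_d (proj1 Gfodc) linearD /= e_lact addrAC subrr add0r.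
move=> a b; rewrite /comm_tau; congr (_ *: _).
apply: linEndP => x; apply/ffunP => i; rewrite !ffunE /=.
case: (unlift ord0 i) => [k|]; first by rewrite comm_X lactC e_lact.
rewrite mulr_sumr -sumrB mulr_sumr; apply: eq_bigr => k _.
by rewrite ffunE comm_X lactC e_lact.
Qed.

(** In the entries k >= 1 of tau(w)(1, ..., 1) only b_0 = 1 enters, and the k-th
    one is i e_k(w). *)
Lemma comm_tau_eq0 (w : G) : comm_tau w = 0 -> forall k, e k w = 0.
Proof.
move=> w0 k.
have := congr1 (fun f : linEnd (dsum A n) => f [ffun=> 1] (lift ord0 k)) w0.
rewrite !ffunE liftK /= ract1 => /eqP.
by rewrite scaler_eq0 complexiE (negPf (Num.Theory.neq0Ci _)) => /eqP.
Qed.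

End CommutatorRepresentation.

Theorem proposition1 (R : realType) (A : hopfAlgType R[i]) (G : bimodType A)
    (d : {linear A -> G}) (dL : {linear G -> tensor A G}) (n : nat)
    (omega : 'I_n -> G) (X : 'I_n -> {scalar A}) (f : 'I_n -> 'I_n -> {scalar A})
    (Gfodc : is_fodc d)
    (Gleft : is_left_coaction d dL)
    (Gbasis : is_basis (left_invariant dL) omega)
    (Xdual : forall k, hopf_dual (X k))
    (fdual : forall k l, hopf_dual (f k l))
    (dX : forall a : A, d a = \sum_(k < n) lact (lhit (X k) a) (omega k))
    (omegaf : forall (k : 'I_n) (a : A),
       ract (omega k) a = \sum_(j < n) lact (lhit (f k j) a) (omega j)) :
  faithful_commutator_rep d (@diag_mul R[i] A n) (commutator_op X).
Proof.
have [e [e_lact e_sum e_omega]] := left_coord Gfodc Gleft Gbasis dX.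
have e_d k a : e k (d a) = lhit (X k) a by rewrite dX e_sum.
have commP := comm_tau_commutator Gfodc e_lact e_d.
split=> [|tau tauP]; first by exists (comm_tau e).
(* A linear map with the prescribed values on the forms a db is unique. *)
have tauE : tau =1 comm_tau e.
  by apply: eq_linear_span (proj2 Gfodc) _ => _ [a [b ->]]; rewrite tauP -commP.
apply: raddf_inj => w tau0.
have /comm_tau_eq0 e0 : comm_tau e w = 0 by rewrite -tauE.
by rewrite (e_omega w) big1 // => k _; rewrite e0 linear0l.
Qed.
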